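(* Let $E\subseteq F$ be compressible countable Borel equivalence relations on a standard Borel space $X$. Then there is a smooth $(E,F)$-link.
   Context: A countable Borel equivalence relation (CBER) on a standard Borel space $X$ is a Borel equivalence relation with countable classes. A CBER $E$ is compressible if there is a Borel injection $T:X\to X$ with $T([x]_E)\subsetneq[x]_E$ for every $x$. A CBER is smooth if there is a Borel set meeting each of its classes in exactly one point. For CBERs $E\subseteq F$, an $(E,F)$-link is a CBER $L\subseteq F$ such that for every $F$-class $C$, every $(E\upharpoonright C)$-class meets every $(L\upharpoonright C)$-class in exactly one point. *)

(* Defs.v *)
From HB Require Import structures.
From mathcomp Require Import all_boot all_order all_algebra.
From mathcomp Require Import all_classical all_reals all_analysis.
From Corelib Require Import RelationClasses.

Set Implicit Arguments.
Unset Strict Implicit.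
Unset Printing Implicit Defensive.

Local Open Scope classical_set_scope.

(* The axiom of the library's [Complete] structure, which has no join with
   [metricType] and requires a pointed space. *)
Definition complete_space (P : uniformType) : Prop :=
  forall F : set_system P, ProperFilter F -> cauchy F ->
    exists l : P, F --> l.

Definition separable_space (P : topologicalType) : Prop :=
  exists2 D : set P, countable D & dense D.

(* (X, measurable) is isomorphic to (P, Borel sets of P) for a Polish P, the
   latter being given with a compatible complete metric. *)
Definition standard_borel (d : measure_display) (X : measurableType d) : Prop :=
  exists (R : realType) (P : metricType R),
    [/\ complete_space P, separable_space P &
        exists2 f : X -> P, bijective f &
          (@measurable d X) = preimage_set_system [set: X] f <<s @open P >>].

Section cber.
Context (d : measure_display) (X : measurableType d).

(* For E : X -> X -> Prop, the E-class of x is the set [E x : set X]. *)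
Definition cber (E : X -> X -> Prop) : Prop :=
  [/\ Equivalence E,
      measurable [set xy : X * X | E xy.1 xy.2] &
      forall x, countable (E x : set X)].

Definition compressible (E : X -> X -> Prop) : Prop :=
  exists T : X -> X,
    [/\ measurable_fun [set: X] T, injective T &
        forall x, T @` (E x : set X) `<` (E x : set X)].

Definition smooth (E : X -> X -> Prop) : Prop :=
  exists2 S : set X, measurable S & forall x, exists! y, (S `&` E x) y.

Definition link (E F L : X -> X -> Prop) : Prop :=
  [/\ cber L,
      forall x y, L x y -> F x y &
      forall x, let C : set X := F x in
        forall y z, C y -> C z ->
          exists! w, ((E y `&` C) `&` (L z `&` C)) w].

End cber.

(* Main.v *)
(** It suffices to find a Borel map [f : X -> X] that restricts to a bijection
    from every E-class onto the F-class containing it: then [f x = f y] is an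
    (E,F)-link, with Borel transversal [{y | y E f y}].

    Such a map comes from a Schröder-Bernstein argument between an E-class D and
    its F-class C.  One injection is the inclusion.  For the other one, let T
    compress E and enumerate F by Borel maps g_n; a point s of C goes to
    T^n(g_a s), where n codes the first pair (a, b) such that g_a s lies in D
    outside the range of T and g_b g_a s = s.

    The maps g_n are provided by the Lusin-Novikov theorem, proved in the Cantor
    space: either an analytic set is covered by countably many Borel graphs, or
    one can build a perfect set inside one of its fibers, a scheme of successive
    splittings being kept alive by the separation of analytic sets.  A standard
    Borel space is coded by a Borel subset of the Cantor space through the
    balls, with rational radii, centered on a dense sequence. *)

Require Import Defs.
From mathcomp Require Import all_boot all_order all_algebra.
From mathcomp Require Import all_classical all_reals all_analysis.
From mathcomp Require Import lra.
From Corelib Require Import RelationClasses.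

Set Implicit Arguments.
Unset Strict Implicit.
Unset Printing Implicit Defensive.

Import Order.TTheory GRing.Theory Num.Theory.

Local Open Scope classical_set_scope.

(** * Borel and analytic sets of sequences *)

(** Dependent choice inside [P]: a choice function on the subtype is iterated. It supplies the
    branches in the separation theorem and in the perfect set construction. *)
Lemma choice_seq (A : Type) (P : A -> Prop) (R : A -> A -> Prop) (a : A) :
  P a -> (forall a, P a -> exists b, P b /\ R a b) ->
  exists f : nat -> A, f 0 = a /\ forall n, P (f n) /\ R (f n) (f n.+1).
Proof.
move=> Pa step.
have /choice[g gP] (b : {a | P a}) : exists c : {a | P a}, R (sval b) (sval c).
  have [c [Pc Rc]] := step _ (svalP b).
  by exists (exist _ c Pc).
exists (fun n => sval (iter n g (exist _ a Pa))); split=> // n; split.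
  exact: svalP.
exact: gP.
Qed.

(** All predicates on one coordinate are generators, so [T] is treated as discrete. The inductive
    form allows proofs by induction on the generation of a Borel set. *)
Inductive borel (T : Type) : set (nat -> T) -> Prop :=
| borel_at (i : nat) (p : T -> Prop) : borel [set x | p (x i)]
| borelC (A : set (nat -> T)) : borel A -> borel (~` A)
| borel_bigcup (A : nat -> set (nat -> T)) :
    (forall n, borel (A n)) -> borel [set x | exists n, A n x].

Section borel_theory.
Context (T : Type).
Implicit Types A B : set (nat -> T).

Lemma borel_cst (p : Prop) : borel [set _ : nat -> T | p].
Proof. exact: (borel_at 0 (fun=> p)). Qed.

Lemma borel_exists (J : countType) (A : J -> set (nat -> T)) :
  (forall j, borel (A j)) -> borel [set x | exists j, A j x].
Proof.
move=> bA; pose A' n := if unpickle n is Some j then A j else [set _ | False].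
suff -> : [set x | exists j, A j x] = [set x | exists n, A' n x].
  apply: borel_bigcup => n; rewrite /A'.
  by case: unpickle => [j|]; [exact: bA | exact: borel_cst].
apply/seteqP; split=> x /= [j Aj].
  by exists (pickle j); rewrite /A' pickleK.
by move: Aj; rewrite /A'; case: unpickle => [k|//]; exists k.
Qed.

Lemma borel_forall (J : countType) (A : J -> set (nat -> T)) :
  (forall j, borel (A j)) -> borel [set x | forall j, A j x].
Proof.
move=> bA; have -> : [set x | forall j, A j x] =
    ~` [set x | exists j, (~` A j) x].
  apply/seteqP; split=> x /= => [h [j]|h j]; first exact.
  by apply: contrapT => nA; apply: h; exists j.
by apply: borelC; apply: borel_exists => j; exact: borelC.
Qed.

Lemma borel_and A B : borel A -> borel B -> borel [set x | A x /\ B x].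
Proof.
move=> bA bB.
have -> : [set x | A x /\ B x] = [set x | forall b : bool, (if b then A else B) x].
  by apply/seteqP; split=> x /= => [[? ?] []//|h]; split; [have := h true|have := h false].
by apply: borel_forall => -[].
Qed.

Lemma borel_imply A B : borel A -> borel B -> borel [set x | A x -> B x].
Proof.
move=> bA bB; have -> : [set x | A x -> B x] = ~` [set x | A x /\ (~` B) x].
  apply/seteqP; split=> x /= => [h [/h] //|h a].
  by apply: contrapT => nb; apply: h.
by apply: borelC; apply: borel_and => //; exact: borelC.
Qed.

End borel_theory.

(* Closed for the product of the discrete topologies. *)
Definition seq_closed (U : Type) (Q : set (nat -> U)) : Prop :=
  forall b, (forall k, exists2 b', Q b' & forall i, i < k -> b i = b' i) -> Q b.

(** The projection of a closed subset of the product with the Baire space; the point and its witness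
    are zipped into a single sequence of pairs. *)
Definition analytic (T : Type) (A : set (nat -> T)) : Prop :=
  exists2 Q : set (nat -> T * nat), seq_closed Q &
    A = [set x | exists2 b, Q b & x = fst \o b].

(** The hypothesis on [m] is continuity of [h] with an explicit modulus. *)
Lemma seq_closed_preimage (U V : Type) (h : (nat -> U) -> nat -> V)
    (m : nat -> nat) (Q : set (nat -> V)) :
  (forall b b' i, (forall j, j <= m i -> b j = b' j) -> h b i = h b' i) ->
  seq_closed Q -> seq_closed (h @^-1` Q).
Proof.
move=> hm cQ b hb; apply: cQ => k.
have [b' Qb' bb'] := hb (\max_(i < k) m i).+1.
exists (h b') => // i ik; apply: hm => j jm; apply: bb'.
by rewrite ltnS (leq_trans jm)// (leq_bigmax (Ordinal ik)).
Qed.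

Section analytic_theory.
Context (T : Type).
Implicit Types A B : set (nat -> T).

Lemma analytic_at (i : nat) (p : T -> Prop) : analytic [set x | p (x i)].
Proof.
exists [set b | p (b i).1].
  move=> b /(_ i.+1)[b' /= pb' bb']; by rewrite bb'.
apply/seteqP; split=> x /= => [px|[b pb ->]//].
by exists (fun j => (x j, 0)).
Qed.

Lemma analytic_cst (p : Prop) : analytic [set _ : nat -> T | p].
Proof. exact: (analytic_at 0 (fun=> p)). Qed.

(** A witness for the union is the index [n] followed by a witness for [A n]; [h] drops this
    index. *)
Lemma analytic_bigcup (A : nat -> set (nat -> T)) :
  (forall n, analytic (A n)) -> analytic [set x | exists n, A n x].
Proof.
move=> aA; have /choice[Q QA] n : exists Q : set (nat -> T * nat),
    seq_closed Q /\ A n = [set x | exists2 b, Q b & x = fst \o b].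
  by have [Q] := aA n; exists Q.
pose h (b : nat -> T * nat) i := ((b i).1, (b i.+1).2).
exists [set b | Q (b 0).2 (h b)].
  move=> b hb /=; set n := (b 0).2.
  have := @seq_closed_preimage _ _ h S (Q n); apply => //.
  - move=> b1 b2 i bb; rewrite /h !bb//.
  - by have [] := QA n.
  move=> k; have [b' Qb' bb'] := hb k.+1; exists b' => [|i ik].
    by move: Qb'; rewrite /n /= bb'.
  by rewrite bb'// ltnW.
apply/seteqP; split=> x /= => [[n]|[b]].
  have [_ ->] := QA n => /= -[b Qb ->].
  exists (fun i => ((b i).1, if i is j.+1 then (b j).2 else n)) => //=.
  by rewrite [h _](_ : _ = b)//; apply/funext => i; rewrite /h/=; case: (b i).
move=> Qb ->; exists (b 0).2; have [_ ->] := QA (b 0).2.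
by exists (h b).
Qed.

Lemma analytic_exists (J : countType) (A : J -> set (nat -> T)) :
  (forall j, analytic (A j)) -> analytic [set x | exists j, A j x].
Proof.
move=> bA; pose A' n := if unpickle n is Some j then A j else [set _ | False].
suff -> : [set x | exists j, A j x] = [set x | exists n, A' n x].
  apply: analytic_bigcup => n; rewrite /A'.
  by case: unpickle => [j|]; [exact: bA | exact: analytic_cst].
apply/seteqP; split=> x /= [j Aj].
  by exists (pickle j); rewrite /A' pickleK.
by move: Aj; rewrite /A'; case: unpickle => [k|//]; exists k.
Qed.

(** One witness interleaves witnesses for all the [A n]; the [n]-th is read along the positions
    [pickle (n, i)]. *)
Lemma analytic_bigcap (A : nat -> set (nat -> T)) :
  (forall n, analytic (A n)) -> analytic [set x | forall n, A n x].
Proof.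
move=> aA; have /choice[Q QA] n : exists Q : set (nat -> T * nat),
    seq_closed Q /\ A n = [set x | exists2 b, Q b & x = fst \o b].
  by have [Q] := aA n; exists Q.
pose h (n : nat) (b : nat -> T * nat) i := ((b i).1, (b (pickle (n, i))).2).
exists [set b | forall n, Q n (h n b)].
  move=> b hb n /=.
  apply: (@seq_closed_preimage _ _ (h n) (fun i => maxn i (pickle (n, i))) (Q n)).
  - by move=> b1 b2 i bb; rewrite /h !bb// ?leq_maxl ?leq_maxr.
  - by have [] := QA n.
  by move=> k; have [b' Qb' bb'] := hb k; exists b'.
apply/seteqP; split=> x /= => [Ax|[b Qb ->] n]; last first.
  by have [_ ->] := QA n; exists (h n b).
have /choice[b bP] n : exists b : nat -> T * nat, Q n b /\ x = fst \o b.
  have := Ax n; have [_ ->] := QA n => -[b Qb xb].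
  by exists b.
exists (fun i => (x i, if unpickle i is Some ni then (b (ni : nat * nat).1 ni.2).2 else 0)) => //.
move=> n; rewrite [h n _](_ : _ = b n); first by have [] := bP n.
by apply/funext => i; rewrite /h/= pickleK/=; have [_ ->] := bP n; rewrite /= -surjective_pairing.
Qed.

Lemma analytic_forall (J : countType) (A : J -> set (nat -> T)) :
  (forall j, analytic (A j)) -> analytic [set x | forall j, A j x].
Proof.
move=> bA; pose A' n := if unpickle n is Some j then A j else [set _ | True].
suff -> : [set x | forall j, A j x] = [set x | forall n, A' n x].
  apply: analytic_bigcap => n; rewrite /A'.
  by case: unpickle => [j|]; [exact: bA | exact: analytic_cst].
apply/seteqP; split=> x /= Ax j.
  by rewrite /A'; case: unpickle => [k|//]; exact: Ax.
by have := Ax (pickle j); rewrite /A' pickleK.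
Qed.

Lemma analytic_and A B :
  analytic A -> analytic B -> analytic [set x | A x /\ B x].
Proof.
move=> aA aB; have -> : [set x | A x /\ B x] =
    [set x | forall b : bool, (if b then A else B) x].
  by apply/seteqP; split=> x /= => [[? ?] []//|h]; split; [have := h true|have := h false].
by apply: analytic_forall => -[].
Qed.

Lemma analytic_or A B :
  analytic A -> analytic B -> analytic [set x | A x \/ B x].
Proof.
move=> aA aB; have -> : [set x | A x \/ B x] =
    [set x | exists b : bool, (if b then A else B) x].
  apply/seteqP; split=> x /= => [[]|[[]]]; [by exists true|by exists false|by left|by right].
by apply: analytic_exists => -[].
Qed.

(** Both halves go through the induction together, as complementation swaps them. *)
Lemma borel_bianalytic A : borel A -> analytic A /\ analytic (~` A).
Proof.
elim=> {A} [i p|A _ [aA aAc]|A _ IH].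
- by split; [exact: analytic_at|exact: (analytic_at i (fun t => ~ p t))].
- by split; rewrite ?setCK.
- split; first by apply: analytic_bigcup => n; have [] := IH n.
  rewrite [~` _](_ : _ = [set x | forall n, (~` A n) x]).
    by apply: analytic_bigcap => n; have [] := IH n.
  by apply/seteqP; split=> x /= h; [move=> n An; apply: h; exists n|case=> n; exact: h].
Qed.

Lemma borel_analytic A : borel A -> analytic A.
Proof. by case/borel_bianalytic. Qed.

Lemma analytic_comp (S : Type) (G : S -> T) A :
  analytic A -> analytic [set x : nat -> S | A (G \o x)].
Proof.
case=> Q cQ ->; pose h (b : nat -> S * nat) i := (G (b i).1, (b i).2).
exists (h @^-1` Q).
  apply: (@seq_closed_preimage _ _ h id) => // b b' i bb'.
  by rewrite /h bb'.
apply/seteqP; split=> x /= => [[b Qb xb]|[b Qb ->]]; last by exists (h b).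
exists (fun i => (x i, (b i).2)) => //; rewrite [h _](_ : _ = b)//.
apply/funext => i; rewrite /h/=; have := congr1 (fun f => f i) xb.
by rewrite /=; case: (b i) => ? ? /= ->.
Qed.

End analytic_theory.

(** As [S] is countable, the sequence projected away can be merged with the old witness into a new
    one. *)
Lemma analytic_proj (T : Type) (S : countType) (A : set (nat -> T * S)) :
  analytic A ->
  analytic [set x | exists y, A (fun i => (x i, y i))].
Proof.
case=> Q cQ ->.
exists [set b | exists y a, Q (fun i => ((b i).1, y i, a i)) /\
    forall i, (b i).2 = pickle (y i, a i)]; last first.
  apply/seteqP; split=> x /= => [[y [b Qb xb]]|[b [y [a [Qb _]]] ->]].
    exists (fun i => (x i, pickle (y i, (b i).2))) => //=.
    exists y, (fun i => (b i).2); split=> //.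
    rewrite [X in Q X](_ : _ = b)//; apply/funext => i.
    by have := congr1 (fun f => f i) xb => /= ->; case: (b i).
  by exists y, (fun i => ((b i).1, y i, a i)).
move=> b hb.
(* Each coordinate decodes on its own, from an approximation agreeing with [b] up to [i];
   injectivity of [pickle] makes these decodings agree with those of any longer approximation. *)
have /choice[ya yaP] i : exists ya : S * nat, (b i).2 = pickle ya.
  have [b' [y [a [_ ba]]] bb'] := hb i.+1.
  by exists (y i, a i); rewrite bb'.
exists (fun i => (ya i).1), (fun i => (ya i).2); split; last first.
  by move=> i; rewrite yaP; case: (ya i).
apply: cQ => k; have [b' [y [a [Qb ba]]] bb'] := hb k.
eexists; first exact: Qb.
move=> i ik /=; rewrite bb'//.
have := ba i; rewrite -bb'// yaP => /(pcan_inj pickleK) ->.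
by [].
Qed.

(** * Separation of disjoint analytic sets by Borel sets *)

Definition borel_separated (T : Type) (A B : set (nat -> T)) : Prop :=
  exists2 D, borel D & A `<=` D /\ B `<=` ~` D.

(** Used contrapositively: if the two unions are not separated, then some pair of pieces is not. *)
Lemma borel_separated_bigcup (T : Type) (I J : countType)
    (A : I -> set (nat -> T)) (B : J -> set (nat -> T)) :
  (forall i j, borel_separated (A i) (B j)) ->
  borel_separated [set x | exists i, A i x] [set x | exists j, B j x].
Proof.
move=> sAB; have /choice[D DP] (ij : I * J) : exists D : set (nat -> T), borel D /\
    (A ij.1 `<=` D /\ B ij.2 `<=` ~` D).
  by have [D ? ?] := sAB ij.1 ij.2; exists D.
exists [set x | exists i, forall j, D (i, j) x].
  by apply: borel_exists => i; apply: borel_forall => j; have [] := DP (i, j).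
split=> x /= => [[i Ai]|[j Bj] [i /(_ j)]].
  by exists i => j; have [_ [+ _]] := DP (i, j); exact.
by have [_ [_]] := DP (i, j); exact.
Qed.

Definition starts (U : Type) (s : seq U) (b : nat -> U) : Prop :=
  mkseq b (size s) = s.

Lemma starts_rcons (U : Type) (s : seq U) (b : nat -> U) :
  starts s b -> starts (rcons s (b (size s))) b.
Proof. by rewrite /starts size_rcons mkseqS => ->. Qed.

Lemma starts_nth (U : Type) (u0 : U) (s : seq U) (b : nat -> U) i :
  starts s b -> i < size s -> b i = nth u0 s i.
Proof. by move=> <-; rewrite size_mkseq => im; rewrite nth_mkseq. Qed.

(** If [A] and [B] are not separated, longer and longer prefixes can be chosen whose pieces are
    still not separated. The two resulting branches give a point of [A] and a point of [B]; these
    differ at some coordinate, and that coordinate already separates two of the pieces. *)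
Lemma analytic_separation (T : countType) (A B : set (nat -> T)) :
  analytic A -> analytic B -> (forall x, A x -> ~ B x) -> borel_separated A B.
Proof.
move=> [Q cQ ->] [Q' cQ' ->] dAB.
pose piece (P : set (nat -> T * nat)) s :=
  [set x | exists2 b, P b /\ starts s b & x = fst \o b].
pose V := (seq (T * nat) * seq (T * nat))%type.
pose bad (v : V) := ~ borel_separated (piece Q v.1) (piece Q' v.2).
apply: contrapT => nsep.
have piece_rcons P s : piece P s = [set x | exists u, piece P (rcons s u) x].
  apply/seteqP; split=> x /= => [[b [Pb sb] ->]|[u [b [Pb sb] ->]]].
    exists (b (size s)), b => //; split=> //; exact: starts_rcons.
  exists b => //; split=> //; move: sb; rewrite /starts size_rcons mkseqS.
  by move=> /rcons_inj[->].
have step v : bad v -> exists uu : (T * nat) * (T * nat),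
    bad (rcons v.1 uu.1, rcons v.2 uu.2).
  move=> bv; apply: contrapT => nbad; apply: bv.
  rewrite !piece_rcons; apply: borel_separated_bigcup => u u'.
  by apply: contrapT => nsu; apply: nbad; exists (u, u').
have bad0 : bad ([::], [::]).
  move=> [D bD [QD Q'D]]; apply: nsep; exists D => //.
  by split=> x /= [b Qb ->]; [apply: QD|apply: Q'D]; exists b.
have [v [v0 vP]] := choice_seq bad0 (R := fun v w : V =>
    exists uu : (T * nat) * (T * nat), w = (rcons v.1 uu.1, rcons v.2 uu.2))
  (fun v bv => let: ex_intro uu buu := step v bv in
     ex_intro _ (rcons v.1 uu.1, rcons v.2 uu.2) (conj buu (ex_intro _ uu erefl))).
have badv n : bad (v n) by have [] := vP n.
have [w wP] := choice (fun n => (vP n).2).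
have v1E n : (v n).1 = mkseq (fst \o w) n.
  by elim: n => [|n IH]; [rewrite v0|rewrite mkseqS wP/= IH].
have v2E n : (v n).2 = mkseq (snd \o w) n.
  by elim: n => [|n IH]; [rewrite v0|rewrite mkseqS wP/= IH].
(* A branch whose prefixes all have nonempty pieces lies in the closed set. *)
have inQ (P : set (nat -> T * nat)) (b : nat -> T * nat) : seq_closed P ->
    (forall n, exists x, piece P (mkseq b n) x) -> P b.
  move=> cP ne; apply: cP => k; have [x [b' [Pb']]] := ne k.
  rewrite /starts size_mkseq => bb' _; exists b' => // i ik.
  have := congr1 (fun s => nth (b i) s i) bb'.
  by rewrite !nth_mkseq.
have Q1 : Q (fst \o w).
  apply: inQ => // n; apply: contrapT => ne; apply: (badv n).
  exists [set _ | False]; first exact: borel_cst.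
  split=> x px /=; last by case.
  by apply: ne; exists x; rewrite -v1E.
have Q2 : Q' (snd \o w).
  apply: inQ => // n; apply: contrapT => ne; apply: (badv n).
  exists [set _ | True]; first exact: borel_cst.
  split=> x px //= _.
  by apply: ne; exists x; rewrite -v2E.
have [i wi] : exists i, (w i).1.1 <> (w i).2.1.
  apply: contrapT => /forallNP ww.
  apply: (dAB (fst \o (fst \o w))); first by exists (fst \o w).
  exists (snd \o w) => //; apply/funext => i /=; exact: contrapT.
apply: (badv i.+1).
have at_i (P : set (nat -> T * nat)) b x : piece P (mkseq b i.+1) x -> x i = (b i).1.
  move=> [b' [_ sb'] ->] /=.
  by rewrite (starts_nth (b i) sb') ?size_mkseq// nth_mkseq.
exists [set x | x i = (w i).1.1]; first exact: (borel_at i (fun t => t = (w i).1.1)).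
split=> x /=; first by rewrite v1E => /at_i.
by rewrite v2E => /at_i -> /= /esym.
Qed.

(** * The Lusin-Novikov theorem *)

Definition join2 (S T : Type) (x : nat -> S) (y : nat -> T) (i : nat) := (x i, y i).

Definition borel_map (f : (nat -> bool) -> nat -> bool) : Prop :=
  forall i, borel [set x | f x i].

(** Two sequences differ at some coordinate, and each bit of a Borel map is decided by a set that is
    analytic along with its complement. *)
Lemma analytic_map_neq (f : nat -> (nat -> bool) -> nat -> bool) :
  (forall n, borel_map (f n)) ->
  analytic [set z : nat -> bool * bool | forall n, snd \o z <> f n (fst \o z)].
Proof.
move=> bf; have -> : [set z : nat -> bool * bool | forall n, snd \o z <> f n (fst \o z)] =
    [set z : nat -> bool * bool | forall n, exists i, ((z i).2 /\ ~ f n (fst \o z) i) \/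
                       (~ (z i).2 /\ f n (fst \o z) i)].
  apply/seteqP; split=> z /= h n.
    apply: contrapT => /forallNP eqzf; apply: (h n); apply/funext => i /=.
    by move: (eqzf i); case: (z i).2; case: (f n _ i) => // -[]; auto.
  have [i + eqzf] := h n; rewrite -eqzf/=.
  by case=> -[].
apply: analytic_forall => n; apply: analytic_exists => i.
have [aT aF] := borel_bianalytic (bf n i).
apply: analytic_or; apply: analytic_and.
- exact: (analytic_at i (fun t : bool * bool => t.2)).
- exact: (analytic_comp (@fst bool bool) aF).
- exact: (analytic_at i (fun t : bool * bool => ~ t.2)).
- exact: (analytic_comp (@fst bool bool) aT).
Qed.

Lemma analytic_two_points (A : set (nat -> bool * bool)) : analytic A ->
  analytic [set x | exists y y', [/\ A (join2 x y), A (join2 x y') & y <> y']].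
Proof.
move=> aA.
have -> : [set x | exists y y', [/\ A (join2 x y), A (join2 x y') & y <> y']] =
    [set x | exists w : nat -> bool * bool,
       [set z : nat -> bool * (bool * bool) |
          A ((fun t => (t.1, t.2.1)) \o z) /\
          (A ((fun t => (t.1, t.2.2)) \o z) /\
           exists i, (z i).2.1 <> (z i).2.2)] (fun i => (x i, w i))].
  apply/seteqP; split=> x /=.
    move=> [y [y' [Ay Ay' yy']]]; exists (join2 y y'); split=> //; split=> //=.
    by apply: contrapT => /forallNP h; apply: yy'; apply/funext => i; exact: contrapT.
  move=> [w [Aw [Aw' [i wi]]]]; exists (fst \o w), (snd \o w); split=> //.
  by move=> /(congr1 (fun f => f i)).
apply: analytic_proj; apply: analytic_and.
  exact: (analytic_comp (fun t : bool * (bool * bool) => (t.1, t.2.1)) aA).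
apply: analytic_and.
  exact: (analytic_comp (fun t : bool * (bool * bool) => (t.1, t.2.2)) aA).
apply: analytic_exists => i.
exact: (analytic_at i (fun t : bool * (bool * bool) => t.2.1 <> t.2.2)).
Qed.

(** The points whose value has [i]-th bit true and those for which it is false form disjoint
    analytic sets, since the graph is single-valued. A Borel set separating them defines the [i]-th
    bit of [f]. *)
Lemma analytic_graph_extension (A : set (nat -> bool * bool)) : analytic A ->
  (forall x y y', A (join2 x y) -> A (join2 x y') -> y = y') ->
  exists2 f, borel_map f & forall x y, A (join2 x y) -> y = f x.
Proof.
move=> aA Afun.
pose V b i := [set x | exists y, [set z : nat -> bool * bool |
   A z /\ (z i).2 = b] (fun j => (x j, y j))].
have aV b i : analytic (V b i).
  apply: analytic_proj; apply: analytic_and => //.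
  exact: (analytic_at i (fun t : bool * bool => t.2 = b)).
have /choice[D DP] i : exists D, borel D /\ (V true i `<=` D /\ V false i `<=` ~` D).
  have [|D bD] := analytic_separation (aV true i) (aV false i); last by exists D.
  move=> x [y [/= Ay yi]] [y' [/= Ay' y'i]].
  by have /(congr1 (fun f => f i)) := Afun _ _ _ Ay Ay'; rewrite yi y'i.
exists (fun x i => `[< D i x >]).
  move=> i; rewrite [X in borel X](_ : _ = D i); first by have [] := DP i.
  by apply/seteqP; split=> x /= /asboolP.
move=> x y Ay; apply/funext => i; have [_ [Vt Vf]] := DP i.
case yi: (y i); apply/esym; [apply/asboolP; apply: Vt|apply/asboolP; apply: Vf].
  by exists y.
by exists y.
Qed.

(** By induction on the list: the points of [M] where [A j] has two values, and those where all the
    other members have two values, form disjoint analytic sets. Let [D] be a Borel set separating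
    them. Inside [D] the induction hypothesis applies; outside, [A j] is single-valued and its graph
    extends to a Borel map. *)
Lemma cover_thin_fibers (J : eqType) (l : seq J) (A : J -> set (nat -> bool * bool))
    (M : set (nat -> bool)) :
  (forall j, analytic (A j)) -> analytic M ->
  (forall x, M x -> exists2 j, j \in l &
     forall y y', A j (join2 x y) -> A j (join2 x y') -> y = y') ->
  exists2 f : nat -> (nat -> bool) -> nat -> bool, (forall n, borel_map (f n)) &
    forall x, M x -> exists2 j, j \in l &
      forall y, A j (join2 x y) -> exists n, y = f n x.
Proof.
move=> aA; elim: l M => [|j l IH] M aM Ml.
  by exists (fun _ x => x) => [n i|x /Ml[]//]; exact: (borel_at i (fun b : bool => b)).
pose two j := [set x | exists y y', [/\ A j (join2 x y), A j (join2 x y') & y <> y']].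
have a2 i : analytic (two i) by exact: analytic_two_points.
have two_all_analytic (l' : seq J) : analytic [set x | forall i, i \in l' -> two i x].
  rewrite (_ : [set x | _] = [set x | forall n : 'I_(size l'), two (nth j l' n) x]).
    by apply: analytic_forall.
  apply/seteqP; split=> x /= h => [n|i]; first by apply: h; rewrite mem_nth.
  by move=> il; have := h (Ordinal (etrans (index_mem i l') il)); rewrite /= nth_index.
have [D bD [jD lD]] : borel_separated [set x | M x /\ two j x]
    [set x | M x /\ forall i, i \in l -> two i x].
  apply: analytic_separation; [exact: analytic_and|exact: (analytic_and aM (two_all_analytic l))|].
  move=> x [Mx jx] [_ lx]; have [i] := Ml x Mx; rewrite inE => /predU1P[->|il] ix.
    by have [y [y' [Ay Ay']]] := jx; apply; exact: ix.
  by have [y [y' [Ay Ay']]] := lx i il; apply; exact: ix.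
have [|x [Mx Dx]|f bf fP] := IH [set x | M x /\ D x].
- by apply: analytic_and => //; exact: borel_analytic.
- apply: contrapT => /forall2NP h; apply: (lD x _ Dx); split=> // i il.
  have [//|h'] := h i; apply: contrapT => n2; apply: h' => y y' Ay Ay'.
  by apply: contrapT => yy'; apply: n2; exists y, y'.
have aDc := (borel_bianalytic bD).2.
have [||g bg gP] := @analytic_graph_extension
    [set z | A j z /\ ((M (fst \o z)) /\ (~` D) (fst \o z))].
- apply: analytic_and => //; apply: analytic_and.
    exact: (analytic_comp (@fst bool bool) aM).
  exact: (analytic_comp (@fst bool bool) aDc).
- move=> x y y' [Ay [/= Mx Dx]] [Ay' _]; apply: contrapT => yy'; apply: Dx.
  by apply: jD; split=> //; exists y, y'.
exists (fun n => if n is k.+1 then f k else g) => [[|n]//|x Mx].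
have [Dx|nDx] := pselect (D x).
  have [//|i il iP] := fP x; exists i; first by rewrite inE il orbT.
  by move=> y /iP[n yn]; exists n.+1.
by exists j; [rewrite inE eqxx|move=> y Ay; exists 0; exact: gP].
Qed.

(** Diagonal argument: by injectivity [d] negates, at place [e h], the bit of [h], which is absurd
    for [h] equal to [d]. *)
Lemma cantor_not_inj_nat (e : (nat -> bool) -> nat) : ~ injective e.
Proof.
move=> e_inj; pose d n := `[< forall h, e h = n -> ~~ h n >].
have dE : d (e d) = ~~ d (e d).
  rewrite {1}/d; apply/asboolP/idP => [|nd h /e_inj ->//].
  exact.
by move: dE; case: (d (e d)).
Qed.

(** * Splitting schemes and perfect sets in fibers *)

Section lusin_novikov.
Let U : countType := ((bool * bool) * nat)%type.
Let u0 : U := (false, false, 0).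
Implicit Types (s : seq U) (l : seq (seq U)).

(** An entry of [U] holds a bit of [x], a bit of [y] and a witness value. The extensions must
    disagree on a bit of [y], so that branches through them give different points when they lie in
    the same fiber. *)
Definition splits s s0 s1 : Prop :=
  [/\ size s < size s0, size s < size s1,
      forall i, i < size s -> nth u0 s0 i = nth u0 s i /\ nth u0 s1 i = nth u0 s i &
      exists i, [/\ i < size s0, i < size s1 &
                    (nth u0 s0 i).1.2 <> (nth u0 s1 i).1.2]].

(** Consecutive levels of a binary tree: the children of the [i]-th node sit at positions [i.*2] and
    [i.*2.+1]. *)
Fixpoint splits_all l l' : Prop :=
  match l, l' with
  | [::], [::] => True
  | s :: l1, [:: s0, s1 & l1'] => splits s s0 s1 /\ splits_all l1 l1'
  | _, _ => False
  end.

Lemma size_splits_all l l' : splits_all l l' -> size l' = (size l).*2.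
Proof. by elim: l l' => [|s l IH] [|s0 [|s1 l']]//= [_ /IH ->]. Qed.

Lemma nth_splits_all l l' i : splits_all l l' -> i < size l ->
  splits (nth [::] l i) (nth [::] l' i.*2) (nth [::] l' i.*2.+1).
Proof.
elim: l l' i => [|s l IH] [|s0 [|s1 l']]//= [|i] [ss ll']//=.
by rewrite ltnS; exact: IH.
Qed.

Lemma splits_mkseq s (b b' : nat -> U) :
  starts s b -> starts s b' -> snd \o (fst \o b) <> snd \o (fst \o b') ->
  exists k k', splits s (mkseq b k) (mkseq b' k').
Proof.
move=> sb sb' bb'; have [i bi] : exists i, (b i).1.2 <> (b' i).1.2.
  by apply: contrapT => /forallNP h; apply: bb'; apply/funext => i; exact: (contrapT (h i)).
(* Long enough to extend [s] strictly and to contain the coordinate [i]. *)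
exists (maxn i (size s)).+1, (maxn i (size s)).+1.
rewrite /splits !size_mkseq !ltnS leq_maxr; split=> // [j js|].
  have jm : j < (maxn i (size s)).+1 by rewrite ltnS leq_max (ltnW js) orbT.
  by rewrite !nth_mkseq// (starts_nth u0 sb js) (starts_nth u0 sb' js).
by exists i; rewrite !ltnS leq_maxl !nth_mkseq ?ltnS ?leq_maxl.
Qed.

Section scheme.
Variable Q : set (nat -> U).
Hypothesis cQ : seq_closed Q.

Definition piece s : set (nat -> bool * bool) :=
  [set z | exists2 b, Q b /\ starts s b & z = fst \o b].

Lemma analytic_piece s : analytic (piece s).
Proof.
exists [set b | Q b /\ starts s b] => // b hb; split.
  by apply: cQ => k; have [b' []] := hb k; exists b'.
have [b' [_ sb'] bb'] := hb (size s).
rewrite /starts -[RHS]sb'; apply/eq_in_map => i.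
by rewrite mem_iota add0n; exact: bb'.
Qed.

(* If l is not thin then some l' obtained by splitting every member of l in two
   is not thin either; iterating yields a perfect set inside one fiber. *)
Definition thin l : Prop :=
  exists2 f : nat -> (nat -> bool) -> nat -> bool, (forall n, borel_map (f n)) &
    forall x, exists2 s, s \in l &
      forall y, piece s (join2 x y) -> exists n, y = f n x.

Lemma splits_all_exists l x (G : set (nat -> bool)) :
  (forall s, s \in l -> exists y y', [/\ piece s (join2 x y) /\ G y,
     piece s (join2 x y') /\ G y' & y <> y']) ->
  exists2 l', splits_all l l' &
    forall s', s' \in l' -> exists2 y, piece s' (join2 x y) & G y.
Proof.
elim: l => [|s l IH] h; first by exists [::].
have [t tl|l' ll' l'P] := IH; first by apply: h; rewrite inE tl orbT.
have [|y [y' [[[b [Qb sb] xyb] Gy] [[b' [Qb' sb'] xyb'] Gy'] yy']]] := h s.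
  by rewrite inE eqxx.
have yb : y = snd \o (fst \o b) by rewrite -xyb.
have yb' : y' = snd \o (fst \o b') by rewrite -xyb'.
have [|k [k' skk']] := splits_mkseq sb sb'; first by rewrite -yb -yb'.
exists [:: mkseq b k, mkseq b' k' & l'] => // s'.
rewrite !inE => /or3P[/eqP->|/eqP->|/l'P//].
  by exists y => //; exists b => //; rewrite /starts size_mkseq.
by exists y' => //; exists b' => //; rewrite /starts size_mkseq.
Qed.

(** There are countably many lists [l'], so one sequence [F] gathers the maps of all thin
    splittings. Remove their graphs from the pieces. If some [x] had two remaining points in every
    piece, then [l] could be split with a remaining point in each new piece, against thinness; so
    [cover_thin_fibers] applies to what remains. *)
Lemma thin_splits l : (forall l', splits_all l l' -> thin l') -> thin l.
Proof.
move=> thin'.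
have /choice[f fP] l' : exists f : nat -> (nat -> bool) -> nat -> bool,
    (forall n, borel_map (f n)) /\ (splits_all l l' ->
    forall x, exists2 s, s \in l' &
      forall y, piece s (join2 x y) -> exists n, y = f n x).
  have [/thin'[f bf fP]|nll'] := pselect (splits_all l l'); first by exists f.
  by exists (fun _ x => x); split=> // n i; exact: (borel_at i (fun b : bool => b)).
pose F m := if unpickle m is Some ln then f (ln : seq (seq U) * nat).1 ln.2 else id.
have bF m : borel_map (F m).
  rewrite /F; case: unpickle => [[l' n]|]; first by have [] := fP l'.
  by move=> i; exact: (borel_at i (fun b : bool => b)).
pose A s := [set z | piece s z /\ forall m, snd \o z <> F m (fst \o z)].
have aA s : analytic (A s).
  by apply: analytic_and; [exact: analytic_piece|exact: analytic_map_neq].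
have [|x _|g bg gP] := @cover_thin_fibers _ l A [set _ | True] aA.
- exact: analytic_cst.
- apply: contrapT => /forall2NP h.
  have [s sl|l' ll' l'P] := @splits_all_exists l x [set y | forall m, y <> F m x].
    have [//|h'] := h s; apply: contrapT => n2; apply: h' => y y' [py ny] [py' ny'].
    by apply: contrapT => yy'; apply: n2; exists y, y'.
  have [_ /(_ ll' x)[s' s'l' s'P]] := fP l'.
  have [y /s'P[n yn] /(_ (pickle (l', n)))] := l'P s' s'l'.
  by rewrite /F pickleK.
exists (fun n => if odd n then F n./2 else g n./2).
  by move=> n; case: ifP.
move=> x; have [//|s sl sP] := gP x; exists s => // y psy.
have [[m ym]|nF] := pselect (exists m, y = F m x).
  by exists m.*2.+1; rewrite /= odd_double uphalf_double.
have [|n yn] := sP y; first by split=> // m ym; apply: nF; exists m.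
by exists n.*2; rewrite odd_double doubleK.
Qed.

(** Otherwise over each [x] some piece has an empty fiber, which any sequence of Borel maps
    covers. *)
Lemma not_thin_common_fiber l : ~ thin l ->
  exists x, forall s, s \in l -> exists y, piece s (join2 x y).
Proof.
move=> nl; apply: contrapT => /forallNP h; apply: nl.
exists (fun _ x => x) => [n i|x]; first exact: (borel_at i (fun b : bool => b)).
apply: contrapT => /forall2NP h'; apply: (h x) => s sl.
have [//|] := h' s; apply: contraPP => /forallNP np h''.
by apply: h'' => y /np.
Qed.

(** Repeated splitting builds a binary tree, along which every [h] follows a branch [b h] of the
    closed set [Q]. Since all nodes of a level meet a common fiber, all branches have the same
    [x]. *)
Lemma not_thin_perfect_fiber : ~ thin [:: [::]] ->
  exists x (y : (nat -> bool) -> nat -> bool),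
    injective y /\ forall h, exists2 b, Q b & join2 x (y h) = fst \o b.
Proof.
move=> n0.
have [l nl|L [L0 LP]] := @choice_seq _ (fun l => ~ thin l) splits_all _ n0.
  apply: contrapT => /forallNP h; apply: nl; apply: thin_splits => l' ll'.
  by apply: contrapT => nl'; apply: (h l').
have ntL n : ~ thin (L n) by have [] := LP n.
have extL n : splits_all (L n) (L n.+1) by have [] := LP n.
(* The position at level [n] is the number with binary digits [h 0], ..., [h n.-1], the leading one
   first. *)
pose fix idx (h : nat -> bool) n := if n is m.+1 then h m + (idx h m).*2 else 0.
have idx_lt h n : idx h n < size (L n).
  elim: n => [|n IH]; first by rewrite L0.
  rewrite (size_splits_all (extL n)) /= -ltn_half_double.
  by case: (h n); rewrite ?add1n ?add0n /= ?uphalf_double ?doubleK.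
pose node h n := nth [::] (L n) (idx h n).
have node_splits h n : splits (node h n) (nth [::] (L n.+1) (idx h n).*2)
    (nth [::] (L n.+1) (idx h n).*2.+1) by exact: nth_splits_all.
have nodeS h n : size (node h n) < size (node h n.+1) /\ forall i,
    i < size (node h n) -> nth u0 (node h n.+1) i = nth u0 (node h n) i.
  have [lt0 lt1 eq01 _] := node_splits h n; rewrite {2 4}/node /=.
  by case: (h n); rewrite ?add0n ?add1n; split=> // i /eq01[].
have size_node h n : n <= size (node h n).
  by elim: n => // n IH; exact: (leq_ltn_trans IH (nodeS h n).1).
have node_stable h n m i : n <= m -> i < size (node h n) ->
    nth u0 (node h m) i = nth u0 (node h n) i.
  move=> nm; have -> : m = (m - n) + n by rewrite subnK.
  elim: (m - n) => // k IH ilt; rewrite addSn (nodeS h _).2 ?IH//.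
  apply: leq_trans ilt _; elim: k {IH} => // k IH.
  by rewrite addSn (leq_trans IH)// ltnW// (nodeS h _).1.
(* At level [i.+1] the node has length at least [i.+1], so its [i]-th entry is final. *)
pose b h i := nth u0 (node h i.+1) i.
have bE h n i : i < size (node h n) -> b h i = nth u0 (node h n) i.
  move=> ilt; rewrite /b; have [le|/ltnW le] := leqP i.+1 n.
    by rewrite [RHS](node_stable _ _ _ _ le)//; exact: size_node.
  exact: node_stable.
have Qb h : Q (b h).
  apply: cQ => k; have [x xP] := not_thin_common_fiber (ntL k).
  have [|y [b' [Qb' sb'] _]] := xP (node h k); first exact: mem_nth.
  exists b' => // i ik; have ilt := leq_trans ik (size_node h k).
  by rewrite (bE _ _ _ ilt) (starts_nth u0 sb').
have bx h h' i : (b h i).1.1 = (b h' i).1.1.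
  have [x xP] := not_thin_common_fiber (ntL i.+1).
  suff bxi k : (b k i).1.1 = x i by rewrite !bxi.
  have [|y [b' [Qb' sb'] xb']] := xP (node k i.+1); first exact: mem_nth.
  have := congr1 (fun f => (f i).1) xb'; rewrite /join2 /= => ->.
  by rewrite /b (starts_nth u0 sb')//; exact: size_node.
exists (fun i => (b (fun=> false) i).1.1), (fun h i => (b h i).1.2); split; last first.
  move=> h; exists (b h) => //; apply/funext => i.
  by rewrite /join2 (bx _ h) /= -surjective_pairing.
move=> h h' yy'; apply: contrapT => hh'.
have ex : exists n, h n != h' n.
  apply: contrapT => /forallNP eqh; apply: hh'; apply/funext => i.
  by have /negP := eqh i; rewrite negbK => /eqP.
(* At the first disagreement both sequences are at the same node and move to different children,
   which differ on a bit of [y]. *)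
case: (ex_minnP ex) => n hn nmin.
have idxE m : m <= n -> idx h m = idx h' m.
  elim: m => //= m IH mn; rewrite IH ?(ltnW mn)//.
  suff -> : h m = h' m by [].
  by apply/eqP; apply: contraTT mn => /nmin; rewrite -leqNgt.
have [_ _ _ [i [i0 i1 nei]]] := node_splits h n.
have e : forall k, idx k n = idx h n -> (b k i).1.2 = if k n
   then (nth u0 (nth [::] (L n.+1) (idx h n).*2.+1) i).1.2
   else (nth u0 (nth [::] (L n.+1) (idx h n).*2) i).1.2.
  move=> k kE.
  have nE : node k n.+1 = nth [::] (L n.+1) (k n + (idx h n).*2).
    by rewrite /node /= kE.
  by rewrite (bE _ n.+1) nE; case: (k n).
have := congr1 (fun f => f i) yy'; rewrite /= (e h erefl) (e h' (esym (idxE n (leqnn n)))).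
by move: hn; case: (h n); case: (h' n) => //= _ ee; apply: nei.
Qed.

End scheme.

(** The piece of the empty prefix is all of [P], so thinness of the one-element list is the
    conclusion. Its failure would embed the Cantor space in a countable fiber. *)
Theorem lusin_novikov (P : set (nat -> bool * bool)) : analytic P ->
  (forall x, countable [set y | P (join2 x y)]) ->
  exists2 f : nat -> (nat -> bool) -> nat -> bool, (forall n, borel_map (f n)) &
    forall x y, P (join2 x y) -> exists n, y = f n x.
Proof.
move=> [Q cQ PE] cP.
have [[f bf fP]|/(not_thin_perfect_fiber cQ)[x [y [y_inj yP]]]] :=
    pselect (thin Q [:: [::]]).
  exists f => // x y; rewrite PE /= => -[b Qb xyb].
  have [s] := fP x; rewrite inE => /eqP -> /(_ y); apply.
  by exists b.
exfalso; have /countable_injP[e e_inj] := cP x.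
apply: (@cantor_not_inj_nat (e \o y)) => h h' /= eyy'; apply: y_inj.
by apply: e_inj => //; apply/mem_set; rewrite /= PE; exact: yP.
Qed.

End lusin_novikov.

(** * Coding standard Borel spaces *)

Lemma borel_preimage (S T : Type) (h : (nat -> S) -> nat -> T) (A : set (nat -> T)) :
  (forall i (p : T -> Prop), borel [set x | p (h x i)]) ->
  borel A -> borel [set x | A (h x)].
Proof.
move=> bh; elim=> {A} [i p|A _ bA|A _ IH]; first exact: bh.
  exact: borelC.
exact: (borel_bigcup IH).
Qed.

Section polish_code.
Local Open Scope ring_scope.
Context (R : realType) (P : metricType R) (e : nat -> P).
Hypothesis complP : complete_space P.
Hypothesis dense_e : forall (y : P) (r : R), 0 < r -> exists n, mdist (e n) y < r.

Definition ball_code (y : P) (m : nat) : bool :=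
  if unpickle m is Some nq
  then `[< mdist (e (nq : nat * rat).1) y < ratr nq.2 >] else false.

Let bit (z : nat -> bool) (n : nat) (q : rat) : Prop := z (pickle (n, q)).

Lemma ball_codeE y n q : bit (ball_code y) n q <-> mdist (e n) y < ratr q.
Proof. by rewrite /bit /ball_code pickleK /=; split=> /asboolP. Qed.

Lemma rat_between (a b : R) : a < b -> exists2 q : rat, a < ratr q & ratr q < b.
Proof. by move=> /rat_in_itvoo[q]; rewrite in_itv /= => /andP[? ?]; exists q. Qed.

(** A ball of radius less than half the distance of two points cannot contain both. *)
Lemma ball_code_inj : injective ball_code.
Proof.
move=> y y' yy'; apply: mdist_positivity; apply/eqP; rewrite eq_le mdist_ge0 andbT.
rewrite leNgt; apply/negP => d0.
have [|q q0 qd] := @rat_between 0 (mdist y y' / 2); first lra.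
have [n ny] := dense_e y q0.
have ny' : mdist (e n) y' < ratr q by apply/ball_codeE; rewrite -yy'; apply/ball_codeE.
have := metric_triangle y (e n) y'; rewrite (metric_sym y (e n)); lra.
Qed.

(* The clauses characterizing the codes: the balls of z shrink to a Cauchy
   filter, and z contains exactly the balls around its limit. *)
Definition is_ball_code (z : nat -> bool) : Prop :=
  (forall m, if unpickle m is Some nq then z m = z (pickle (nq : nat * rat)) else ~~ z m) /\
  [/\ forall q : rat, 0 < q -> exists n, bit z n q,
      forall n m (q r : rat), bit z n q -> bit z m r -> mdist (e n) (e m) < ratr q + ratr r,
      forall n (q : rat), bit z n q -> exists2 r : rat, r < q & bit z n r &
      forall n m (q r : rat), ratr q + mdist (e n) (e m) <= ratr r ->
        bit z n q -> bit z m r].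

Lemma range_ball_code : range ball_code = is_ball_code.
Proof.
apply/seteqP; split=> z.
  move=> [y _ <-]; split=> [m|].
    by rewrite /ball_code; case: unpickle => [nq|//]; rewrite pickleK.
  split=> [q q0|n m q r|n q|n m q r qr].
  - have [|n ny] := dense_e y (r := ratr q); first by rewrite ltr0q.
    by exists n; apply/ball_codeE.
  - move=> /ball_codeE ny /ball_codeE my.
    have := metric_triangle (e n) y (e m); rewrite (metric_sym y (e m)); lra.
  - move=> /ball_codeE /rat_between[r yr rq]; exists r; last exact/ball_codeE.
    by rewrite -(ltr_rat R).
  - move=> /ball_codeE ny; apply/ball_codeE.
    have := metric_triangle (e m) (e n) y; rewrite (metric_sym (e m) (e n)); lra.
move=> [z0 [z1 z2 z3 z4]].
have zmono n (q r : rat) : q <= r -> bit z n q -> bit z n r.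
  by move=> qr; apply: z4; rewrite mdistxx addr0 ler_rat.
(* The filter of the sets containing the centers of all balls of [z] of some radius; its limit is
   the point coded by [z]. *)
pose F : set_system P := [set A | exists2 q : rat, 0 < q & forall n, bit z n q -> A (e n)].
have FF : ProperFilter F.
  split; first by move=> [q /z1[n nq] /(_ n nq)].
  split; first by exists 1.
    move=> A B [q q0 qA] [r r0 rB]; exists (Num.min q r); first by rewrite lt_min q0.
    move=> n nqr; split; [apply: qA|apply: rB]; apply: zmono nqr.
      by rewrite ge_min lexx.
    by rewrite ge_min lexx orbT.
  by move=> A B AB [q q0 qA]; exists q => // n /qA; exact: AB.
have [|l Fl] := complP FF.
  apply: cauchy_exP => eps eps0; have [|q q0 qeps] := @rat_between 0 (eps / 2); first lra.
  move: q0; rewrite ltr0q => q0; have [n nq] := z1 q q0.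
  exists (e n), q => // m mq; rewrite ballEmdist /=.
  by have := z2 _ _ _ _ nq mq; lra.
have near_l (r : R) : 0 < r -> exists n (q : rat),
    [/\ bit z n q, ratr q < r & mdist (e n) l < r].
  move=> r0; have [q q0 ql] := (fcvg_ballP l).1 Fl r r0.
  have [s s0 sr] := rat_between r0; move: s0; rewrite ltr0q => s0.
  have [|n nqs] := z1 (Num.min q s); first by rewrite lt_min q0.
  have qs1 : Num.min q s <= q by rewrite ge_min lexx.
  have qs2 : ratr (Num.min q s) <= ratr s :> R by rewrite ler_rat ge_min lexx orbT.
  exists n, (Num.min q s); split=> //; first exact: le_lt_trans sr.
  by have := ql n (zmono _ _ _ qs1 nqs); rewrite ballEmdist /= metric_sym.
(* One direction first shrinks the radius, to leave room for a tiny ball of [z] near [l]; the other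
   enlarges such a tiny ball. *)
have bit_l n q : bit z n q <-> mdist (e n) l < ratr q.
  split=> [/z3[r]|nl].
    rewrite -(ltr_rat R) => rq nr.
    have [|m [s [ms sr ml]]] := near_l ((ratr q - ratr r) / 2); first lra.
    have := metric_triangle (e n) (e m) l; have := z2 _ _ _ _ nr ms; lra.
  have [|m [s [ms sr ml]]] := near_l ((ratr q - mdist (e n) l) / 2); first lra.
  apply: (z4 m) ms; have := metric_triangle (e m) l (e n); rewrite (metric_sym l (e n)); lra.
(* An index may decode to a pair without being its [pickle]; the first clause settles those bits,
   and the ones decoding to nothing. *)
exists l => //; apply/funext => m; have := z0 m; rewrite /ball_code.
case: unpickle => [[n q]|/negbTE ->//] ->.
by apply/asboolP/idP => /bit_l.
Qed.

Lemma borel_bit (n : nat) (q : rat) : borel [set z | bit z n q].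
Proof. exact: (borel_at (pickle (n, q)) (fun b : bool => b)). Qed.

(** Every quantifier in [is_ball_code] ranges over a countable type. *)
Lemma borel_range_ball_code : borel (range ball_code).
Proof.
have borel_i (i : nat) : borel [set z : nat -> bool | z i].
  exact: (borel_at i (fun b : bool => b)).
rewrite range_ball_code.
have -> : is_ball_code = [set z : nat -> bool |
  (forall m, if unpickle m is Some nq
     then (z m -> z (pickle (nq : nat * rat))) /\ (z (pickle nq) -> z m) else ~ z m) /\
  ((forall q : rat, 0 < q -> exists n, bit z n q) /\
   ((forall n m (q r : rat), bit z n q -> bit z m r ->
      mdist (e n) (e m) < ratr q + ratr r) /\
   ((forall n (q : rat), bit z n q -> exists r : rat, r < q /\ bit z n r) /\
    forall n m (q r : rat), ratr q + mdist (e n) (e m) <= ratr r ->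
        bit z n q -> bit z m r)))].
  apply/seteqP; split=> z [z0 zP]; split.
  - move=> m; have := z0 m; case: unpickle => [nq ->//|]; exact: negP.
  - case: zP => z1 z2 z3 z4; do !split=> //; move=> n q /z3[r]; by exists r.
  - move=> m; have := z0 m; case: unpickle => [nq [h h']|/negP//].
    exact/idP/idP.
  - case: zP => z1 [z2 [z3 z4]]; split=> // n q /z3[r []]; by exists r.
apply: borel_and.
  apply: borel_forall => m; case: unpickle => [nq|]; last exact: (borelC (borel_i m)).
  exact: (borel_and (borel_imply (borel_i m) (borel_i (pickle nq)))
    (borel_imply (borel_i (pickle nq)) (borel_i m))).
apply: borel_and.
  apply: borel_forall => q; apply: borel_imply; first exact: borel_cst.
  by apply: borel_exists => n; exact: borel_bit.
apply: borel_and.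
  apply: borel_forall => n; apply: borel_forall => m; apply: borel_forall => q.
  apply: borel_forall => r; apply: borel_imply; first exact: borel_bit.
  apply: borel_imply; [exact: borel_bit|exact: borel_cst].
apply: borel_and.
  apply: borel_forall => n; apply: borel_forall => q.
  apply: borel_imply; first exact: borel_bit.
  apply: borel_exists => r; apply: borel_and; [exact: borel_cst|exact: borel_bit].
apply: borel_forall => n; apply: borel_forall => m; apply: borel_forall => q.
apply: borel_forall => r; apply: borel_imply; first exact: borel_cst.
apply: borel_imply; exact: borel_bit.
Qed.

Lemma open_mdist_lt (y : P) (r : R) : open [set y' | mdist y y' < r].
Proof.
rewrite openE => y' /= yy'; apply/nbhs_ballP; exists (r - mdist y y') => /=.
  by rewrite subr_gt0.
move=> w; rewrite ballEmdist /= => y'w.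
have := metric_triangle y y' w; lra.
Qed.

(** An open set is the union of the rational balls, with centers among the [e n], that it
    contains. *)
Lemma open_ball_code (O : set P) : open O ->
  exists2 B, borel B & O = ball_code @^-1` B.
Proof.
move=> oO; exists [set z | exists n q,
    (forall y, mdist (e n) y < ratr q -> O y) /\ bit z n q].
  apply: borel_exists => n; apply: borel_exists => q.
  by apply: borel_and; [exact: borel_cst|exact: borel_bit].
apply/seteqP; split=> y /=; last by move=> [n [q [h /ball_codeE]]]; exact: h.
move: oO; rewrite openE => /[apply] /nbhs_ballP[r /= r0 rO].
have [|q q0 qr] := @rat_between 0 (r / 2); first lra.
have [n ny] := dense_e y q0; exists n, q; split; last exact/ball_codeE.
move=> y' ny'; apply: rO; rewrite ballEmdist /=.
have := metric_triangle y (e n) y'; rewrite (metric_sym y (e n)); lra.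
Qed.

End polish_code.

(** The sequence inverts an injection of [D] into the integers; [p0] fills the indices that are not
    reached. *)
Lemma separable_dense_seq (R : realType) (P : metricType R) (p0 : P) :
  separable_space P ->
  exists e : nat -> P, forall (y : P) (r : R), (0 < r)%R -> exists n, (mdist (e n) y < r)%R.
Proof.
move=> [D /countable_injP[g g_inj] dD].
have /choice[e eP] n : exists p, forall q, D q -> g q = n -> q = p.
  have [[p [Dp gp]]|np] := pselect (exists p, D p /\ g p = n).
    by exists p => q Dq gq; apply: g_inj; rewrite ?inE// gq.
  by exists p0 => q Dq gq; exfalso; apply: np; exists q.
exists e => y r r0.
have [||p [yp Dp]] := dD [set p | (mdist y p < r)%R].
- by exists y => /=; rewrite mdistxx.
- exact: open_mdist_lt.
by exists (g p); rewrite -(eP _ _ Dp erefl) metric_sym.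
Qed.

(** A Borel isomorphism onto a Borel subset of the Cantor space. *)
Definition borel_code (d : measure_display) (X : measurableType d)
    (c : X -> nat -> bool) : Prop :=
  [/\ injective c, forall B, borel B -> measurable (c @^-1` B),
      forall A, measurable A -> exists2 B, borel B & A = c @^-1` B &
      borel (range c)].

Lemma standard_borel_coded (d : measure_display) (X : measurableType d) :
  standard_borel X -> exists c : X -> nat -> bool, borel_code c.
Proof.
move=> [R [P [complP sepP [f bij_f mX]]]].
have [e dense_e] := separable_dense_seq (f point) sepP.
have mpre B : <<s @open P >> B -> measurable (f @^-1` B).
  by move=> sB; rewrite mX; exists B => //; rewrite setTI.
exists (ball_code e \o f); split.
- exact: inj_comp (ball_code_inj dense_e) (bij_inj bij_f).
- move=> B; elim=> {B} [i p|B _ mB|B _ IH].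
  + have mi : measurable [set x | ball_code e (f x) i].
      rewrite /ball_code; case: unpickle => [[n q]|]; last first.
        by rewrite [X in measurable X](_ : _ = set0)//; apply/seteqP; split.
      rewrite [X in measurable X](_ : _ = f @^-1` [set y | (mdist (e n) y < ratr q)%R]).
        by apply: mpre; apply: sub_gen_smallest; exact: open_mdist_lt.
      by apply/seteqP; split=> x /= /asboolP.
    (* A predicate on a bit is one of four: always true, the bit, its negation, always false. *)
    have [pt|npt] := pselect (p true); have [pf|npf] := pselect (p false).
    * rewrite [X in measurable X](_ : _ = setT)//; apply/seteqP; split=> // x _ /=.
      by case: ball_code.
    * rewrite [X in measurable X](_ : _ = [set x | ball_code e (f x) i])//.
      by apply/seteqP; split=> x /=; case: ball_code.
    * rewrite [X in measurable X](_ : _ = ~` [set x | ball_code e (f x) i]).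
        exact: measurableC.
      by apply/seteqP; split=> x /=; case: ball_code.
    * rewrite [X in measurable X](_ : _ = set0)//; apply/seteqP; split=> // x /=.
      by case: ball_code.
  + exact: measurableC.
  + rewrite [X in measurable X](_ : _ = \bigcup_n ((ball_code e \o f) @^-1` B n)).
      exact: bigcupT_measurable.
    by apply/seteqP; split=> x /= [n]; [exists n|move=> _ ?; exists n].
- move=> A; rewrite mX => -[B sB <-]; rewrite setTI.
  have : [set B | exists2 B', borel B' & B = ball_code e @^-1` B'] B.
    apply: smallest_sub sB; last by move=> O; exact: (open_ball_code dense_e).
    split=> [|B1 [B' bB' ->]|G GP].
    + by exists [set _ | False]; [exact: borel_cst|].
    + by exists (~` B'); [exact: borelC|rewrite setTD].
    + have /choice[G' G'P] n : exists B', borel B' /\ G n = ball_code e @^-1` B'.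
        by have [B' ? ?] := GP n; exists B'.
      exists [set z | exists n, G' n z].
        by apply: borel_bigcup => n; have [] := G'P n.
      apply/seteqP; split=> y /= [n]; last by exists n => //; rewrite (G'P n).2.
      by rewrite (G'P n).2 => _ ?; exists n.
  by move=> [B' bB' ->]; exists B'.
- rewrite [X in borel X](_ : _ = range (ball_code e)).
    exact: borel_range_ball_code.
  have [g fg gf] := bij_f.
  apply/seteqP; split=> z [x _ <-]; first by exists (f x).
  by exists (g x) => //=; rewrite gf.
Qed.

(** * Enumeration of the classes by Borel maps *)

Section coded.
Context (d : measure_display) (X : measurableType d) (c : X -> nat -> bool).
Hypothesis codec : borel_code c.

Lemma borel_code_prod (S : set (X * X)) : measurable S ->
  exists2 B : set (nat -> bool * bool), borel B &
    forall x y, S (x, y) <-> B (join2 (c x) (c y)).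
Proof.
have [_ _ mc _] := codec.
rewrite measurable_prod_measurableType => sS.
suff : [set S | exists2 B : set (nat -> bool * bool), borel B &
    forall x y, S (x, y) <-> B (join2 (c x) (c y))] S by [].
apply: smallest_sub sS.
  split=> [|S1 [B bB SB]|G GP].
  - by exists [set _ | False]; [exact: borel_cst|].
  - exists (~` B); first exact: borelC.
    by move=> x y; rewrite setTD /=; split=> h /SB.
  - have /choice[B BP] n : exists B : set (nat -> bool * bool), borel B /\
        forall x y, G n (x, y) <-> B (join2 (c x) (c y)).
      by have [B ? ?] := GP n; exists B.
    exists [set z | exists n, B n z].
      by apply: borel_bigcup => n; have [] := BP n.
    move=> x y; split=> [[n _ /(BP n).2]|[n /(BP n).2]]; by exists n.
move=> _ [A1 mA1 [A2 mA2 <-]].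
have [B1 bB1 ->] := mc _ mA1; have [B2 bB2 ->] := mc _ mA2.
exists [set z | B1 (fst \o z) /\ B2 (snd \o z)]; last by [].
apply: borel_and.
  apply: (@borel_preimage _ _ (fun z : nat -> bool * bool => fst \o z)) => // i p.
  exact: (borel_at i (fun t : bool * bool => p t.1)).
apply: (@borel_preimage _ _ (fun z : nat -> bool * bool => snd \o z)) => // i p.
exact: (borel_at i (fun t : bool * bool => p t.2)).
Qed.

(** Lusin-Novikov is applied to the codes of the pairs in [F]. Each covering map is pulled back
    through [c] where its value codes a point of the class; elsewhere [g n] is the identity, which
    stays in the class. *)
Lemma cber_enumeration (F : X -> X -> Prop) : cber F ->
  exists g : nat -> X -> X,
    [/\ forall n, measurable_fun [set: X] (g n), forall n x, F x (g n x) &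
        forall x y, F x y -> exists n, y = g n x].
Proof.
move=> [eqF mF cF]; have [c_inj cm mc bc] := codec.
have [B bB FB] := borel_code_prod mF.
(* Restricted to codes, every section is empty or contained in the image of an F-class, hence
   countable. *)
pose F' := [set z | B z /\ (range c (fst \o z) /\ range c (snd \o z))].
have [||f bf fP] := @lusin_novikov F'.
- have arc := borel_analytic bc; apply: analytic_and; first exact: borel_analytic.
  apply: analytic_and.
    exact: (analytic_comp (@fst bool bool) arc).
  exact: (analytic_comp (@snd bool bool) arc).
- move=> z; have [[x _ <-]|nz] := pselect (range c z).
    apply: sub_countable (cF x); apply: (@card_le_trans _ _ _ (c @` F x)); last exact: card_image_le.
    apply: subset_card_le => y [Bxy [_ [y' _ y'y]]] /=.
    by exists y' => //; apply/FB; rewrite y'y.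
  by rewrite [X in countable X](_ : _ = set0)//; apply/seteqP; split=> // y [_ [/nz]].
pose W n x := exists y, F x y /\ c y = f n (c x).
have /choice[g gP] (nx : nat * X) : exists y, F nx.2 y /\
    if `[< W nx.1 nx.2 >] then c y = f nx.1 (c nx.2) else y = nx.2.
  case: asboolP => [[y [Fy cy]]|_]; first by exists y.
  by exists nx.2; split=> //; reflexivity.
have bf' n i (p : bool -> Prop) : borel [set z | p (f n z i)].
  rewrite [X in borel X](_ : _ = [set z | exists b : bool, p b /\
      ((f n z i -> b) /\ (b -> f n z i))]).
    apply: borel_exists => b; apply: (borel_and (@borel_cst bool (p b))).
    exact: (borel_and (borel_imply (bf n i) (@borel_cst bool b))
      (borel_imply (@borel_cst bool b) (bf n i))).
  apply/seteqP; split=> z /= => [pz|[b [pb [h h']]]]; first by exists (f n z i).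
  by rewrite (_ : f n z i = b)//; exact/idP/idP.
have mW n : measurable [set x | W n x].
  rewrite [X in measurable X](_ : _ = c @^-1`
      [set z | range c (f n z) /\ B (join2 z (f n z))]).
    apply: cm; apply: borel_and; first exact: (borel_preimage (bf' n)).
    apply: (@borel_preimage _ _ (fun z => join2 z (f n z))) => // i p.
    rewrite [X in borel X](_ : _ = [set z | exists b : bool, z i = b /\ p (b, f n z i)]).
      apply: borel_exists => b; apply: borel_and; last exact: (bf' n i (fun b' => p (b, b'))).
      exact: (borel_at i (fun b' => b' = b)).
    apply/seteqP; split=> z /= => [pz|[b [<-]]//]; by exists (z i).
  apply/seteqP; split=> x /= => [[y [/FB Fy <-]]|[[y _ yf]]]; first by split=> //; exists y.
  by rewrite -yf => /FB Fy; exists y.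
exists (fun n x => g (n, x)); split=> [n _ M mM|n x|x y Fxy].
- rewrite setTI; have [BM bBM ME] := mc _ mM.
  rewrite [X in measurable X](_ : _ = ([set x | W n x] `&` c @^-1` [set z | BM (f n z)])
      `|` (~` [set x | W n x] `&` M)).
    apply: measurableU; apply: measurableI => //; last exact: measurableC.
    by apply: cm; exact: (borel_preimage (bf' n)).
  apply/seteqP; split=> x /=; have [_] := gP (n, x); case: asboolP => /= wx gx.
  + by rewrite [M]ME /= gx; left.
  + by rewrite gx; right.
  + by case=> -[//] _; rewrite [M]ME /= gx.
  + by case=> -[//] _; rewrite gx.
- by have [] := gP (n, x).
- have [|n yn] := fP (c x) (c y); first by split; [exact/FB|split; [exists x|exists y]].
  exists n; apply: c_inj; rewrite yn; have [_] := gP (n, x).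
  by case: asboolP => //= nW; exfalso; apply: nW; exists y.
Qed.

(** Equality is tested on the bits of the codes, one at a time. *)
Lemma measurable_eq_fun (d' : measure_display) (Y : measurableType d') (h h' : Y -> X) :
  measurable_fun [set: Y] h -> measurable_fun [set: Y] h' ->
  measurable [set x | h x = h' x].
Proof.
have [c_inj cm _ _] := codec => mh mh'.
have mi (k : Y -> X) i : measurable_fun [set: Y] k -> measurable [set x | c (k x) i].
  move=> mk; rewrite -[X in measurable X]setTI.
  apply: (mk measurableT [set x | c x i]).
  exact: (cm _ (borel_at i (fun b : bool => b))).
rewrite [X in measurable X](_ : _ = \bigcap_i
    (([set x | c (h x) i] `&` [set x | c (h' x) i]) `|`
     (~` [set x | c (h x) i] `&` ~` [set x | c (h' x) i]))).
  apply: bigcapT_measurable => i; apply: measurableU; apply: measurableI => //;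
    [exact: mi|exact: mi|apply: measurableC; exact: mi|apply: measurableC; exact: mi].
apply/seteqP; split=> x /= => [hx i _ /=|hx].
  by rewrite hx; have [|] := EM (c (h' x) i); [left|right].
apply: c_inj; apply/funext => i.
by apply/idP/idP => ci; have /= [[]|[]] := hx i I.
Qed.

End coded.

(** * Links *)

Section measurable_formulas.
Context (d : measure_display) (X : measurableType d).
Implicit Types P Q : X -> Prop.

Lemma measurable_not P : measurable [set x | P x] -> measurable [set x | ~ P x].
Proof. exact: measurableC. Qed.

Lemma measurable_and P Q : measurable [set x | P x] -> measurable [set x | Q x] ->
  measurable [set x | P x /\ Q x].
Proof. exact: measurableI. Qed.

Lemma measurable_or P Q : measurable [set x | P x] -> measurable [set x | Q x] ->
  measurable [set x | P x \/ Q x].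
Proof. exact: measurableU. Qed.

Lemma measurable_exists (P : nat -> X -> Prop) :
  (forall n, measurable [set x | P n x]) -> measurable [set x | exists n, P n x].
Proof.
move=> mP; rewrite [X in measurable X](_ : _ = \bigcup_n [set x | P n x]).
  exact: bigcupT_measurable.
by apply/seteqP; split=> x /= [n]; [exists n|move=> _ ?; exists n].
Qed.

Lemma measurable_forall (P : nat -> X -> Prop) :
  (forall n, measurable [set x | P n x]) -> measurable [set x | forall n, P n x].
Proof.
move=> mP; rewrite [X in measurable X](_ : _ = \bigcap_n [set x | P n x]).
  exact: bigcapT_measurable.
by apply/seteqP; split=> x /= Px n; [move=> _|]; exact: Px.
Qed.

Lemma measurable_cst_imply (p : Prop) P :
  measurable [set x | P x] -> measurable [set x | p -> P x].
Proof.
move=> mP; have [hp|np] := pselect p.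
  by rewrite [X in measurable X](_ : _ = [set x | P x])//; apply/seteqP; split=> x /=; auto.
by rewrite [X in measurable X](_ : _ = setT)//; apply/seteqP; split=> x //= _ /np.
Qed.

Lemma measurable_pred_comp P (h : X -> X) : measurable_fun [set: X] h ->
  measurable [set x | P x] -> measurable [set x | P (h x)].
Proof. by move=> mh mP; have := mh measurableT _ mP; rewrite setTI. Qed.

Lemma cber_measurable_comp (E : X -> X -> Prop) (h h' : X -> X) : cber E ->
  measurable_fun [set: X] h -> measurable_fun [set: X] h' ->
  measurable [set x | E (h x) (h' x)].
Proof.
move=> [_ mE _] mh mh'.
by have := measurable_fun_pair mh mh' measurableT mE; rewrite setTI.
Qed.

End measurable_formulas.

(* A Schröder-Bernstein argument run in every E-class D at once: J relates the
   points of D to the values of an injection of the ambient F-class into D,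
   whose other half is the inclusion of D. *)
Section class_bijection.
Context (X : Type) (E F J : X -> X -> Prop).
Hypotheses (eqE : Equivalence E) (eqF : Equivalence F).
Hypothesis JF : forall x s, J x s -> F x s.
Hypothesis J_ex : forall x s, F x s -> exists2 x', E x x' & J x' s.
Hypothesis J_inj : forall x x' s, E x x' -> J x s -> J x' s -> x = x'.
Hypothesis J_fun : forall x s s', J x s -> J x s' -> s = s'.

(** [J x s] says that [x] is the image of [s], so following [J] traces the ancestry of [x]; here it
    first leaves the E-class after [k.+1] steps. *)
Fixpoint escapes (k : nat) (x : X) : Prop :=
  match k with
  | 0 => exists s, J x s /\ ~ E x s
  | k'.+1 => exists s, J x s /\ (E x s /\ escapes k' s)
  end.

(** Points whose ancestry leaves the class go back to their parent; the others are fixed. *)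
Definition class_map_graph (x s : X) : Prop :=
  ((exists k, escapes k x) /\ J x s) \/ (~ (exists k, escapes k x) /\ s = x).

Lemma class_map_exists : exists f : X -> X, forall x, class_map_graph x (f x).
Proof.
suff /choice[f fP] : forall x, exists s, class_map_graph x s by exists f.
move=> x; rewrite /class_map_graph.
have [[k xk]|nx] := pselect (exists k, escapes k x); last by exists x; right.
by have [s [Jxs _]] : exists s, J x s /\ True;
  [case: k xk => [|k] [s [Js _]]; exists s|exists s; left; split=> //; exists k].
Qed.

Variable f : X -> X.
Hypothesis fP : forall x, class_map_graph x (f x).

Lemma class_map_graphE x s : class_map_graph x s <-> s = f x.
Proof.
split=> [|->//]; case: (fP x) => [[ex Jf]|[nex ->]] [[ex' Js]|[nex' ->]] //.
exact: J_fun Js Jf.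
Qed.

Lemma class_map_sub x : F x (f x).
Proof.
case: (fP x) => [[_ /JF//]|[_ ->]]; reflexivity.
Qed.

Lemma class_map_inj x x' : E x x' -> f x = f x' -> x = x'.
Proof.
(* If the parent of an escaping point is still in the class, it escapes too, so it cannot be a fixed
   point of the second kind. *)
have mixed y y' : E y y' -> (exists k, escapes k y) -> J y (f y) ->
    ~ (exists k, escapes k y') -> f y = y' -> False.
  move=> Eyy' [k yk] Jy ny' fy; apply: ny'; rewrite -fy in Eyy' *.
  case: k yk => [[s [/(J_fun Jy) <- //]]|k [s [/(J_fun Jy) <- [_]]]]; by exists k.
move=> Exx' ff'; case: (fP x) => [[ex Jx]|[nex fx]]; case: (fP x') => [[ex' Jx']|[nex' fx']].
- by apply: (J_inj Exx' Jx); rewrite ff'.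
- by exfalso; apply: (mixed x x') => //; rewrite ff'.
- by exfalso; apply: (mixed x' x) => //; [symmetry|rewrite -ff'].
- by rewrite -fx ff'.
Qed.

(** Let [x'] be the image of [s] in the class. If [s] is outside the class or escapes, then [x']
    escapes and is sent to [s]; otherwise [s] is fixed. *)
Lemma class_map_surj x s : F x s -> exists2 x', E x x' & f x' = s.
Proof.
move=> Fxs; have [x' Exx' Jx's] := J_ex Fxs.
have hit : (exists k, escapes k x') -> exists2 x', E x x' & f x' = s.
  by move=> ex; exists x' => //; apply/esym/class_map_graphE; left.
have [Ex's|nE] := pselect (E x' s); last by apply: hit; exists 0, s.
have [[k sk]|ns] := pselect (exists k, escapes k s).
  by apply: hit; exists k.+1, s.
exists s; first by transitivity x'.
by apply/esym/class_map_graphE; right.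
Qed.

End class_bijection.

(** * Injecting an F-class into each of its E-classes by means of the compression *)

Section compression.
Context (d : measure_display) (X : measurableType d) (c : X -> nat -> bool).
Hypothesis codec : borel_code c.
Context (E F : X -> X -> Prop).
Hypotheses (cE : cber E) (cF : cber F) (sEF : forall x y, E x y -> F x y).
Variable T : X -> X.
Hypotheses (mT : measurable_fun [set: X] T) (T_inj : injective T).
Hypothesis T_lt : forall x, T @` (E x : set X) `<` (E x : set X).
Variable g : nat -> X -> X.
Hypotheses (mg : forall n, measurable_fun [set: X] (g n)) (gF : forall n x, F x (g n x)).
Hypothesis g_surj : forall x y, F x y -> exists n, y = g n x.

Let eqE : Equivalence E. Proof. by case: cE. Qed.
Let eqF : Equivalence F. Proof. by case: cF. Qed.
#[local] Existing Instances eqE eqF.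

Lemma compression_sub x : E x (T x).
Proof. by have [sub _] := T_lt x; apply: sub; exists x => //=; reflexivity. Qed.

Lemma compression_iter_sub n x : E x (iter n T x).
Proof.
elim: n => [|n IH]; first reflexivity.
by transitivity (iter n T x) => //; exact: compression_sub.
Qed.

(** The complement of the range of [T], written with the [g n] to make its measurability visible: a
    preimage of [y] under [T] is in the F-class of [y]. *)
Definition base (y : X) : Prop := ~ exists n, T (g n y) = y.

Lemma baseP y : base y <-> forall w, T w <> y.
Proof.
split=> [by_ w Tw|h [n]]; last exact: h.
have [n wn] : exists n, w = g n y.
  by apply: g_surj; symmetry; rewrite -Tw; apply: sEF; exact: compression_sub.
by apply: by_; exists n; rewrite -wn.
Qed.

Lemma base_meets x : exists2 y, E x y & base y.
Proof.
have [_ /existsNP[y /not_implyP[Exy ny]]] := T_lt x.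
exists y => //; apply/baseP => w Tw; apply: ny; exists w => //=.
by transitivity y => //; symmetry; rewrite -Tw; exact: compression_sub.
Qed.

Lemma base_iter_inj n m y y' : base y -> base y' ->
  iter n T y = iter m T y' -> n = m /\ y = y'.
Proof.
move=> /baseP by_ /baseP by'; elim: n m => [|n IH] [|m] //=.
- by move=> yT; exfalso; apply: (by_ (iter m T y')).
- by move=> Ty; exfalso; apply: (by' (iter n T y)).
- by move=> /T_inj /IH[-> ->].
Qed.

(** The default pair is harmless, since [reaches] tests whatever pair is decoded. *)
Let cod (n : nat) : nat * nat := odflt (0, 0) (unpickle n).

Definition reaches (n : nat) (s x : X) : Prop :=
  base (g (cod n).1 s) /\ (E (g (cod n).1 s) x /\ g (cod n).2 (g (cod n).1 s) = s).

(* The injection of the F-class of x into the E-class of x sends s to T^n(y),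
   where y is a base point of the E-class from which s is recovered, and both
   are read off the least suitable n; distinct points (n, y) have distinct
   images since T is injective and misses the base. *)
Definition coded_in (x s : X) : Prop :=
  exists n, reaches n s x /\ ((forall m, m < n -> ~ reaches m s x) /\
    iter n T (g (cod n).1 s) = x).

Lemma reaches_class n s x x' : E x x' -> reaches n s x -> reaches n s x'.
Proof. by move=> Exx' [b [Ex gs]]; split=> //; split=> //; transitivity x. Qed.

Lemma coded_in_sub x s : coded_in x s -> F x s.
Proof.
move=> [n [[_ [Ex gs]] _]]; transitivity (g (cod n).1 s).
  by symmetry; exact: sEF.
by symmetry; exact: gF.
Qed.

Lemma coded_in_exists x s : F x s -> exists2 x', E x x' & coded_in x' s.
Proof.
move=> Fxs; have [y Exy base_y] := base_meets x.
have Fsy : F s y by transitivity x; [symmetry|exact: sEF].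
have [a ya] := g_surj Fsy; have [b sb] : exists b, s = g b y by apply: g_surj; symmetry.
have ex : exists n, `[< reaches n s x >].
  exists (pickle (a, b)); apply/asboolP; rewrite /reaches /cod pickleK /= -ya.
  by split=> //; split=> //; symmetry.
case: (ex_minnP ex) => n /asboolP rn nmin.
have Ex' : E x (iter n T (g (cod n).1 s)).
  by have [_ [Ex _]] := rn; transitivity (g (cod n).1 s);
    [symmetry|exact: compression_iter_sub].
exists (iter n T (g (cod n).1 s)) => //; exists n; split; first exact: reaches_class rn.
split=> // m mn rm; move: (nmin m); rewrite leqNgt mn => h; apply/negP: isT.
by apply: h; apply/asboolP; apply: reaches_class rm; symmetry.
Qed.

(** The least suitable index depends only on [s] and the E-class, so it is the same for both
    points. *)
Lemma coded_in_inj x x' s : E x x' -> coded_in x s -> coded_in x' s -> x = x'.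
Proof.
move=> Exx' [n [rn [nmin nE]]] [m [rm [mmin mE]]]; rewrite -nE -mE.
suff -> : n = m by [].
apply/eqP; rewrite eqn_leq; apply/andP; split; rewrite leqNgt; apply/negP.
  by move=> /nmin; apply; apply: reaches_class rm; symmetry.
by move=> /mmin; apply; exact: reaches_class rn.
Qed.

(** By [base_iter_inj], [x] determines the index and the base point, from which the second component
    of the index recovers [s]. *)
Lemma coded_in_fun x s s' : coded_in x s -> coded_in x s' -> s = s'.
Proof.
move=> [n [[bn [_ ns]] [_ nE]]] [m [[bm [_ ms]] [_ mE]]].
have [|nm yy'] := base_iter_inj (n := n) (m := m) bn bm; first by rewrite nE mE.
by rewrite -ns -ms; rewrite yy' nm.
Qed.

Lemma measurable_iter n : measurable_fun [set: X] (iter n T).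
Proof.
elim: n => [|n IH]; first exact: measurable_id.
exact: (measurableT_comp mT IH).
Qed.

Lemma measurable_base : measurable [set y | base y].
Proof.
apply: measurable_not; apply: measurable_exists => n.
by apply: (measurable_eq_fun codec); [exact: measurableT_comp|exact: measurable_id].
Qed.

Lemma measurable_reaches n (h h' : X -> X) : measurable_fun [set: X] h ->
  measurable_fun [set: X] h' -> measurable [set x | reaches n (h x) (h' x)].
Proof.
move=> mh mh'; have mgh k : measurable_fun [set: X] (fun x => g k (h x)).
  exact: (measurableT_comp (mg k) mh).
apply: measurable_and; first exact: (measurable_pred_comp (mgh _) measurable_base).
apply: measurable_and; first exact: cber_measurable_comp.
apply: (measurable_eq_fun codec) => //; exact: (measurableT_comp (mg _) (mgh _)).
Qed.

Lemma measurable_coded_in (h h' : X -> X) : measurable_fun [set: X] h ->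
  measurable_fun [set: X] h' -> measurable [set x | coded_in (h x) (h' x)].
Proof.
move=> mh mh'; apply: measurable_exists => n.
apply: measurable_and; first exact: measurable_reaches.
apply: measurable_and.
  apply: measurable_forall => m; apply: measurable_cst_imply.
  by apply: measurable_not; exact: measurable_reaches.
apply: (measurable_eq_fun codec) => //.
exact: (measurableT_comp (measurable_iter n) (measurableT_comp (mg _) mh')).
Qed.

(** As [coded_in] is contained in [F], the quantifier over [s] reduces to one over the points
    [g n x]. *)
Lemma measurable_escapes k : measurable [set x | escapes E coded_in k x].
Proof.
elim: k => [|k IH].
  rewrite [X in measurable X](_ : _ = [set x | exists n, coded_in x (g n x) /\ ~ E x (g n x)]).
    apply: measurable_exists => n; apply: measurable_and.
      by apply: measurable_coded_in => //; exact: measurable_id.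
    by apply: measurable_not; apply: cber_measurable_comp => //; exact: measurable_id.
  apply/seteqP; split=> x /= => [[s [xs nE]]|[n]]; last by exists (g n x).
  by have [n sn] := g_surj (coded_in_sub xs); exists n; rewrite -sn.
rewrite [X in measurable X](_ : _ = [set x | exists n, coded_in x (g n x) /\
    (E x (g n x) /\ escapes E coded_in k (g n x))]).
  apply: measurable_exists => n; apply: measurable_and.
    by apply: measurable_coded_in => //; exact: measurable_id.
  apply: measurable_and; last exact: measurable_pred_comp IH.
  by apply: cber_measurable_comp => //; exact: measurable_id.
apply/seteqP; split=> x /= => [[s [xs sP]]|[n]]; last by exists (g n x).
by have [n sn] := g_surj (coded_in_sub xs); exists n; rewrite -sn.
Qed.

Lemma measurable_class_bijection : exists f : X -> X,
  [/\ measurable_fun [set: X] f, forall x, F x (f x),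
      forall x x', E x x' -> f x = f x' -> x = x' &
      forall x s, F x s -> exists2 x', E x x' & f x' = s].
Proof.
have [f fP] := class_map_exists E coded_in.
have fF := class_map_sub eqF coded_in_sub fP.
exists f; split.
- move=> _ M mM; rewrite setTI.
  rewrite [X in measurable X](_ : _ = [set x | exists n,
      class_map_graph E coded_in x (g n x) /\ M (g n x)]).
    have mesc : measurable [set x | exists k, escapes E coded_in k x].
      by apply: measurable_exists => k; exact: measurable_escapes.
    apply: measurable_exists => n; apply: measurable_and; last first.
      exact: (measurable_pred_comp (mg n) mM).
    apply: measurable_or; apply: measurable_and => //.
    + by apply: measurable_coded_in => //; exact: measurable_id.
    + exact: measurable_not.
    + by apply: (measurable_eq_fun codec) => //; exact: measurable_id.
  apply/seteqP; split=> x /= => [Mf|[n [/(class_map_graphE coded_in_fun fP) <-]]//].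
  by have [n fn] := g_surj (fF x); exists n; rewrite -fn.
- exact: fF.
- move=> x x'; exact: (class_map_inj eqE coded_in_inj coded_in_fun fP).
- exact: (class_map_surj eqE coded_in_exists coded_in_fun fP).
Qed.

End compression.

(** The classes of the link are the fibers of [f], and bijectivity on an E-class says that it meets
    each fiber in its F-class exactly once. *)
Lemma link_of_class_bijection (d : measure_display) (X : measurableType d)
    (c : X -> nat -> bool) (E F : X -> X -> Prop) (f : X -> X) :
  borel_code c -> cber E -> cber F -> (forall x y, E x y -> F x y) ->
  measurable_fun [set: X] f -> (forall x, F x (f x)) ->
  (forall x x', E x x' -> f x = f x' -> x = x') ->
  (forall x s, F x s -> exists2 x', E x x' & f x' = s) ->
  link E F (fun x y => f x = f y) /\ smooth (fun x y => f x = f y).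
Proof.
move=> codec cE cF sEF mf fF f_inj f_surj.
have [eqE _ _] := cE; have [eqF _ countF] := cF.
have sLF x y : f x = f y -> F x y.
  by move=> fxy; transitivity (f x) => //; rewrite fxy; symmetry.
split; first split=> //.
- split.
  + by split=> [x|x y|x y z] // -> .
  + exact: (measurable_eq_fun codec (measurableT_comp mf measurable_fst)
      (measurableT_comp mf measurable_snd)).
  + by move=> x; apply: sub_countable (countF x); apply: subset_card_le => y; exact: sLF.
- move=> x C y z Cy Cz.
  have [|w Eyw fw] := f_surj y (f z).
    by transitivity z => //; transitivity x => //; symmetry.
  exists w; split.
    split; split=> //; by [rewrite /C; transitivity y => //; exact: sEF|].
  move=> w' [[Eyw' _] [fw' _]]; apply: f_inj; last by rewrite fw.
  by transitivity y => //; symmetry.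
(* In the fiber over [s], this set selects the points that are in the E-class of [s], and there is
   exactly one. *)
exists [set y | E y (f y)].
  by apply: cber_measurable_comp => //; exact: measurable_id.
move=> x; have [|y Ey fy] := f_surj (f x) (f x); first reflexivity.
exists y; split.
  by split=> //=; rewrite fy; symmetry.
move=> y' [/= Ey' fy']; apply: f_inj; last by rewrite fy.
by transitivity (f x); [symmetry|rewrite fy'; symmetry].
Qed.

Theorem theorem3p6 (d : measure_display) (X : measurableType d)
    (E F : X -> X -> Prop) :
  standard_borel X ->
  cber E -> cber F -> (forall x y, E x y -> F x y) ->
  compressible E -> compressible F ->
  exists L : X -> X -> Prop, link E F L /\ smooth L.
Proof.
move=> /standard_borel_coded[c codec] cE cF sEF [T [mT T_inj T_lt]] _.
have [g [mg gF g_surj]] := cber_enumeration codec cF.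
have [f [mf fF f_inj f_surj]] :=
  measurable_class_bijection codec cE cF sEF mT T_inj T_lt mg gF g_surj.
by exists (fun x y => f x = f y); exact: (link_of_class_bijection codec).
Qed.
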